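(* Let $p$ be an odd prime and let $e=\#\mathcal{E}^*$. If $4e+8<\frac{p-1}{2}$, then there exists a pair $(\alpha,\beta)\in(\mathbb{Z}/(p-1)\mathbb{Z})^2$ with $\alpha+\beta$ odd such that: (a) $(\alpha,\beta)$ is not a solution $(x,y)$ of any of the equations $2x=\pm\epsilon$, $2y=\pm\epsilon$ for $\epsilon\in\bar{\mathcal{E}}$; (b) $(\alpha,\beta)$ is not a solution of any of the equations $y=\pm x\pm\epsilon$ for $\epsilon\in\bar{\mathcal{E}}$, all equations taken in $\mathbb{Z}/(p-1)\mathbb{Z}$.
   Context: $\bar\chi$ is the mod-$p$ cyclotomic character. Let $\mathcal{C}$ be the class group of $\mathbb{Q}(\mu_p)$ tensored with $\mathbb{F}_p$, with the natural action of $\operatorname{Gal}(\mathbb{Q}(\mu_p)/\mathbb{Q})$, and for $i\in\mathbb{Z}/(p-1)\mathbb{Z}$ let $\mathcal{C}(\bar\chi^i)=\{x\in\mathcal{C}:g\cdot x=\bar\chi^i(g)x\ \forall g\}$. Let $\mathcal{E}=\{\epsilon\in\mathbb{Z}/(p-1)\mathbb{Z}:\mathcal{C}(\bar\chi^\epsilon)\neq0\}$, $\mathcal{E}^*=\{p-\epsilon\in\mathbb{Z}/(p-1)\mathbb{Z}:\epsilon\in\mathcal{E}\}\setminus\{0,\tfrac{p-1}{2}\}$, and $\bar{\mathcal{E}}=\mathcal{E}^*\cup\{0,1,\tfrac{p-1}{2}\}$. *)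

(* Defs.v *)
From HB Require Import structures.
From mathcomp Require Import all_boot all_order all_algebra all_fingroup.
From mathcomp Require Import all_solvable all_field all_character.
From mathcomp Require Import boolp classical_sets.

Set Implicit Arguments.
Unset Strict Implicit.
Unset Printing Implicit Defensive.

Import GRing.Theory.
Local Open Scope ring_scope.
Local Open Scope quotient_scope.

Section ClassGroup.
Variable L : fieldExtType rat.

Definition ring_of_integers : set L :=
  [set x | integralOver (intr : int -> L) x]%classic.
Local Notation OL := ring_of_integers.

Lemma OL0 : OL 0. Proof. exact: integral0. Qed.
Lemma OL1 : OL 1. Proof. exact: integral1. Qed.
Lemma OLD x y : OL x -> OL y -> OL (x + y). Proof. exact: integral_add. Qed.
Lemma OLM x y : OL x -> OL y -> OL (x * y). Proof. exact: integral_mul. Qed.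

Definition is_submodule (I : set L) : Prop :=
  [/\ I 0, forall x y, I x -> I y -> I (x + y)
    & forall a x, OL a -> I x -> I (a * x)].

Definition is_fractional_ideal (I : set L) : Prop :=
  [/\ is_submodule I, exists2 x, I x & x != 0
    & exists d, [/\ OL d, d != 0 & forall x, I x -> OL (d * x)]].

Definition ideal_mul (I J : set L) : set L :=
  [set x | exists2 s : seq (L * L),
     (forall u, u \in s -> I u.1 /\ J u.2) & x = \sum_(u <- s) u.1 * u.2]%classic.

Definition principal_ideal (a : L) : set L :=
  [set x | exists2 b, OL b & x = a * b]%classic.

Definition is_invertible_ideal (I : set L) : Prop :=
  is_fractional_ideal I /\
  exists2 J, is_fractional_ideal J & ideal_mul I J = OL.

Lemma ideal_mul_min I J K : is_submodule K ->
  (forall x y, I x -> J y -> K (x * y)) -> (ideal_mul I J `<=` K)%classic.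
Proof.
move=> [K0 KD _] IJK _ [s sP ->]; elim: s sP => [|u s IHs] sP.
  by rewrite big_nil.
rewrite big_cons; apply: KD; last by apply: IHs => v vs; apply: sP; rewrite inE vs orbT.
by have [] := sP u (mem_head _ _); apply: IJK.
Qed.

Lemma ideal_mul_gen (I J : set L) x y : I x -> J y -> ideal_mul I J (x * y).
Proof.
move=> Ix Jy; exists [:: (x, y)]; last by rewrite big_seq1.
by move=> u; rewrite inE => /eqP ->.
Qed.

Lemma ideal_mul_submodule I J :
  is_submodule I -> is_submodule (ideal_mul I J).
Proof.
move=> [_ _ IZ]; split.
- by exists [::] => //; rewrite big_nil.
- move=> x y [s sP ->] [t tP ->]; exists (s ++ t); last by rewrite big_cat.
  by move=> u; rewrite mem_cat => /orP[/sP|/tP].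
move=> a x Oa [s sP ->]; exists [seq (a * u.1, u.2) | u <- s].
  by move=> _ /mapP[u /sP[Iu Ju] ->]; split=> //; apply: IZ.
by rewrite big_map mulr_sumr; apply: eq_bigr => u _; rewrite mulrA.
Qed.

Lemma ideal_mulC : commutative ideal_mul.
Proof.
suff sub I J : (ideal_mul I J `<=` ideal_mul J I)%classic.
  by move=> I J; apply/seteqP; split; apply: sub.
move=> x [s sP ->]; exists [seq (u.2, u.1) | u <- s].
  by move=> _ /mapP[u /sP[Iu Ju] ->].
by rewrite big_map; apply: eq_bigr => u _; rewrite mulrC.
Qed.

Lemma ideal_mulA I J K : is_submodule I -> is_submodule J -> is_submodule K ->
  ideal_mul I (ideal_mul J K) = ideal_mul (ideal_mul I J) K.
Proof.
have shift (A : set L) y : is_submodule A ->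
    is_submodule [set x | A (x * y)]%classic.
  move=> [A0 AD AZ]; split=> [|u v Au Av|a u Oa Au] /=; first by rewrite mul0r.
    by rewrite mulrDl; apply: AD.
  by rewrite -mulrA; apply: AZ.
have sub A B C : is_submodule A -> is_submodule B ->
    (ideal_mul (ideal_mul A B) C `<=` ideal_mul A (ideal_mul B C))%classic.
  move=> mA mB; have mABC := @ideal_mul_submodule A (ideal_mul B C) mA.
  apply: ideal_mul_min => // x y ABx Cy.
  have := @ideal_mul_min A B _ (shift _ y mABC); apply=> // a b Aa Bb /=.
  by rewrite -mulrA; apply: ideal_mul_gen => //; apply: ideal_mul_gen.
move=> mI mJ mK; apply/seteqP; split; last exact: sub.
rewrite ideal_mulC (ideal_mulC J) (ideal_mulC _ K) (ideal_mulC I).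
exact: sub.
Qed.

Lemma OL_submodule : is_submodule OL.
Proof. by split; [exact: OL0|exact: OLD|exact: OLM]. Qed.

Lemma ideal_mul1 I : is_submodule I -> ideal_mul OL I = I.
Proof.
move=> mI; apply/seteqP; split=> [|x Ix].
  by apply: ideal_mul_min => // x y; case: mI => _ _; apply.
by rewrite -[x]mul1r; apply: ideal_mul_gen => //; apply: OL1.
Qed.

Lemma OL_fractional : is_fractional_ideal OL.
Proof.
split; first exact: OL_submodule.
  by exists 1; [exact: OL1|exact: oner_neq0].
by exists 1; split; [exact: OL1|exact: oner_neq0|move=> x; rewrite mul1r].
Qed.

Lemma ideal_mul_fractional I J : is_fractional_ideal I ->
  is_fractional_ideal J -> is_fractional_ideal (ideal_mul I J).
Proof.
move=> [mI [x Ix x0] [c [Oc c0 cI]]] [mJ [y Jy y0] [d [Od d0 dJ]]]; split.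
- exact: ideal_mul_submodule.
- by exists (x * y); [exact: ideal_mul_gen|exact: mulf_neq0].
exists (c * d); split; [exact: OLM|exact: mulf_neq0|] => z [s sP ->].
rewrite mulr_sumr; elim: s sP => [|u s IHs] sP.
  by rewrite big_nil; apply: OL0.
rewrite big_cons; apply: OLD; last first.
  by apply: IHs => v vs; apply: sP; rewrite inE vs orbT.
have [/cI Ou /dJ Ov] := sP u (mem_head _ _).
by rewrite mulrACA; apply: OLM.
Qed.

Lemma OL_invertible : is_invertible_ideal OL.
Proof.
split; [exact: OL_fractional|exists OL; [exact: OL_fractional|]].
exact/ideal_mul1/OL_submodule.
Qed.

Lemma ideal_mul_invertible I J : is_invertible_ideal I ->
  is_invertible_ideal J -> is_invertible_ideal (ideal_mul I J).
Proof.
move=> [fI [I' fI' II']] [fJ [J' fJ' JJ']]; split.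
  exact: ideal_mul_fractional.
have [[mI _ _] [mI' _ _] [mJ _ _] [mJ' _ _]] := And4 fI fI' fJ fJ'.
exists (ideal_mul J' I'); first exact: ideal_mul_fractional.
rewrite -ideal_mulA //; last exact: ideal_mul_submodule.
by rewrite (@ideal_mulA J) // JJ' ideal_mul1.
Qed.

(* O_L is a Dedekind domain, so that every nonzero fractional ideal is
   invertible; requiring invertibility gives the group structure without
   invoking this theorem. *)
Record fideal : Type := Fideal {
  fideal_set :> set L;
  fidealP : `[< is_invertible_ideal fideal_set >] }.

HB.instance Definition _ := [isSub for fideal_set].
HB.instance Definition _ := [Choice of fideal by <:].

Definition mk_fideal I (h : is_invertible_ideal I) : fideal :=
  Fideal (introT (asboolP _) h).

Lemma fideal_inv (I : fideal) : is_invertible_ideal I.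
Proof. exact/asboolP/fidealP. Qed.

Lemma fideal_submodule (I : fideal) : is_submodule I.
Proof. by have [[]] := fideal_inv I. Qed.

Lemma fideal_has_inverse (I : fideal) :
  exists J : fideal, ideal_mul I J = OL.
Proof.
have [fI [J fJ IJ]] := fideal_inv I.
have iJ : is_invertible_ideal J by split=> //; exists I => //; rewrite ideal_mulC.
by exists (mk_fideal iJ).
Qed.

(* The group of fractional ideals, written additively: 0 is O_L and + is the
   product of ideals. *)
Definition fideal0 : fideal := mk_fideal OL_invertible.
Definition fideal_add (I J : fideal) : fideal :=
  mk_fideal (ideal_mul_invertible (fideal_inv I) (fideal_inv J)).
Definition fideal_opp (I : fideal) : fideal := sval (cid (fideal_has_inverse I)).

Lemma fideal_addA : associative fideal_add.
Proof.
move=> I J K; apply/val_inj/ideal_mulA; exact: fideal_submodule.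
Qed.

Lemma fideal_addC : commutative fideal_add.
Proof. by move=> I J; apply/val_inj/ideal_mulC. Qed.

Lemma fideal_add0 : left_id fideal0 fideal_add.
Proof. move=> I; apply/val_inj/ideal_mul1; exact: fideal_submodule. Qed.

Lemma fideal_addN : left_inverse fideal0 fideal_opp fideal_add.
Proof.
move=> I; rewrite fideal_addC; apply/val_inj.
by rewrite /= /fideal_opp; case: cid.
Qed.

HB.instance Definition _ := GRing.isZmodule.Build fideal
  fideal_addA fideal_addC fideal_add0 fideal_addN.

Definition is_principal : {pred fideal} :=
  fun I => `[< exists2 a : L, a != 0 & (I : set L) = principal_ideal a >].

Lemma principal_ideal_submodule c : is_submodule (principal_ideal c).
Proof.
split=> [|x y [u Ou ->] [v Ov ->]|d x Od [u Ou ->]].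
- by exists 0; [exact: OL0|rewrite mulr0].
- by exists (u + v); [exact: OLD|rewrite mulrDr].
by exists (d * u); [exact: OLM|rewrite mulrCA].
Qed.

Lemma principal_idealM a b :
  ideal_mul (principal_ideal a) (principal_ideal b) = principal_ideal (a * b).
Proof.
apply/seteqP; split.
  apply: ideal_mul_min; first exact: principal_ideal_submodule.
  move=> x y [u Ou ->] [v Ov ->].
  by exists (u * v); [exact: OLM|rewrite mulrACA].
move=> x [u Ou ->]; rewrite -mulrA; apply: ideal_mul_gen.
  by exists 1; [exact: OL1|rewrite mulr1].
by exists u.
Qed.

Lemma principal_ideal1 : principal_ideal 1 = OL.
Proof.
apply/seteqP; split=> [x [u Ou ->]|x Ox]; first by rewrite mul1r.
by exists x => //; rewrite mul1r.
Qed.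

Lemma principal_ideal_opp (J : fideal) b : b != 0 ->
  (J : set L) = principal_ideal b ->
  (- J : fideal) = principal_ideal b^-1 :> set L.
Proof.
move=> b0 Jb; have mP := principal_ideal_submodule.
have JN : ideal_mul J (- J : fideal) = OL.
  by rewrite -[ideal_mul _ _]/(fideal_set (J + - J)) addrN.
rewrite -[LHS]ideal_mul1; last exact: fideal_submodule.
have <- : ideal_mul (principal_ideal b^-1) J = OL.
  by rewrite Jb principal_idealM mulVf // principal_ideal1.
rewrite -ideal_mulA ?JN //; [|exact: fideal_submodule..].
by rewrite ideal_mulC ideal_mul1.
Qed.

Lemma is_principal_zmod_closed : zmod_closed is_principal.
Proof.
split=> [|I J /asboolP[a a0 Ia] /asboolP[b b0 Jb]]; apply/asboolP.
  by exists 1; [exact: oner_neq0|rewrite principal_ideal1].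
exists (a * b^-1); first by rewrite mulf_neq0 ?invr_eq0.
by rewrite -principal_idealM -Ia -(principal_ideal_opp b0 Jb).
Qed.

HB.instance Definition _ := GRing.isZmodClosed.Build fideal is_principal
  is_principal_zmod_closed.

Definition class_group : zmodType := Quotient.quot is_principal.

Section ModP.
Variable p : nat.

Definition is_pmultiple : {pred class_group} :=
  fun x => `[< exists y : class_group, x = y *+ p >].

Lemma is_pmultiple_zmod_closed : zmod_closed is_pmultiple.
Proof.
split=> [|_ _ /asboolP[x ->] /asboolP[y ->]]; apply/asboolP.
  by exists 0; rewrite mul0rn.
by exists (x - y); rewrite mulrnBl.
Qed.

HB.instance Definition _ := GRing.isZmodClosed.Build class_group is_pmultiple
  is_pmultiple_zmod_closed.

(* The class group tensored with F_p, as Cl / p Cl. *)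
Definition class_group_modp : zmodType := Quotient.quot is_pmultiple.

Lemma class_group_modpMn (x : class_group_modp) : x *+ p = 0.
Proof.
elim/quotW: x => x; rewrite -raddfMn /=; apply/eqP.
rewrite -(raddf0 \pi_class_group_modp%qT) -Quotient.idealrBE subr0.
by apply/asboolP; exists x.
Qed.

(* The F_p-vector space structure, see class_group_modpMn. *)
Definition Fp_scale (a : 'F_p) (x : class_group_modp) : class_group_modp :=
  x *+ (a : nat).
End ModP.
End ClassGroup.

Section GaloisAction.
Variable L : splittingFieldType rat.
Implicit Type g : gal_of {:L}.

Definition gal_set g (I : set L) : set L := (g @` I)%classic.

Lemma gal_OL g : gal_set g (@ring_of_integers L) = @ring_of_integers L.
Proof.
have sub (h : gal_of {:L}) x : ring_of_integers x -> ring_of_integers (h x).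
  move=> Ox; have [q q_mon qx] := Ox; exists q => //.
  have -> : map_poly intr q = map_poly h (map_poly intr q).
    by apply/polyP=> i; rewrite !coef_map /= rmorph_int.
  by rewrite /root horner_map (eqP qx) rmorph0.
apply/seteqP; split=> [_ [x Ox <-]|x Ox]; first exact: sub.
exists (g^-1%g x); first exact: sub.
by rewrite -galM ?memvf // mulVg gal_id.
Qed.

Lemma gal_set_mul g I J :
  gal_set g (ideal_mul I J) = ideal_mul (gal_set g I) (gal_set g J).
Proof.
apply/seteqP; split=> [_ [_ [s sP ->] <-]|_ [s sP ->]].
  exists [seq (g u.1, g u.2) | u <- s].
    by move=> _ /mapP[u /sP[Iu Ju] ->]; split; [exists u.1|exists u.2].
  by rewrite rmorph_sum big_map; apply: eq_bigr => u _; rewrite rmorphM.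
elim: s sP => [|u s IHs] sP.
  by rewrite big_nil; exists 0; [exists [::]; rewrite ?big_nil|rewrite rmorph0].
have [[x Ix xE] [y Jy yE]] := sP u (mem_head _ _).
have [|_ [t tP ->] tE] := IHs.
  by move=> v vs; apply: sP; rewrite inE vs orbT.
exists (\sum_(v <- (x, y) :: t) v.1 * v.2).
  by exists ((x, y) :: t) => // v; rewrite inE => /orP[/eqP ->|/tP].
by rewrite !big_cons rmorphD rmorphM /= xE yE tE.
Qed.

Lemma gal_set_principal g a :
  gal_set g (principal_ideal a) = principal_ideal (g a).
Proof.
apply/seteqP; split=> [_ [_ [b Ob ->] <-]|_ [b + ->]].
  by exists (g b); [rewrite -(gal_OL g); exists b|rewrite rmorphM].
rewrite -(gal_OL g) => -[c Oc <-].
by exists (a * c); [exists c|rewrite rmorphM].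
Qed.

Lemma gal_set_fractional g I :
  is_fractional_ideal I -> is_fractional_ideal (gal_set g I).
Proof.
have OLg x : ring_of_integers x -> ring_of_integers (g x).
  by move=> Ox; rewrite -(gal_OL g); exists x.
move=> [[I0 ID IZ] [x Ix x0] [d [Od d0 dI]]]; split.
- split=> [|_ _ [u Iu <-] [v Iv <-]|a _ Oa [u Iu <-]].
  + by exists 0; rewrite ?rmorph0.
  + by exists (u + v); [exact: ID|rewrite rmorphD].
  + move: Oa; rewrite -(gal_OL g) => -[c Oc <-].
    by exists (c * u); [exact: IZ|rewrite rmorphM].
- by exists (g x); [exists x|rewrite fmorph_eq0].
exists (g d); split; [exact: OLg|by rewrite fmorph_eq0|] => _ [u Iu <-].
by rewrite -rmorphM; apply/OLg/dI.
Qed.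

Lemma gal_set_invertible g I :
  is_invertible_ideal I -> is_invertible_ideal (gal_set g I).
Proof.
move=> [fI [J fJ IJ]]; split; first exact: gal_set_fractional.
exists (gal_set g J); first exact: gal_set_fractional.
by rewrite -gal_set_mul IJ gal_OL.
Qed.

Definition gal_fideal g (I : fideal L) : fideal L :=
  mk_fideal (gal_set_invertible g (fideal_inv I)).

Lemma gal_fideal_is_zmod_morphism g : zmod_morphism (gal_fideal g).
Proof.
have gD I J : gal_fideal g (I + J) = gal_fideal g I + gal_fideal g J.
  exact/val_inj/gal_set_mul.
by move=> I J; apply: (addIr (gal_fideal g J)); rewrite -gD !subrK.
Qed.

HB.instance Definition _ g := GRing.isZmodMorphism.Build (fideal L) (fideal L)
  (gal_fideal g) (gal_fideal_is_zmod_morphism g).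

(* The Galois action on the quotients, defined on representatives; it is
   compatible with the projections by the lemmas gal_class_pi and
   gal_class_modp_pi. *)
Definition gal_class g (x : class_group L) : class_group L :=
  \pi_(class_group L) (gal_fideal g (generic_quotient.repr x)).

Lemma gal_class_pi g I :
  gal_class g (\pi_(class_group L) I) = \pi_(class_group L) (gal_fideal g I).
Proof.
apply/eqP; rewrite /gal_class -Quotient.idealrBE -raddfB /=.
have : generic_quotient.repr (\pi_(class_group L) I) - I \in @is_principal L.
  by rewrite Quotient.idealrBE reprK.
move=> /asboolP[a a0 Ia]; apply/asboolP; exists (g a).
  by rewrite fmorph_eq0.
by rewrite -gal_set_principal -Ia.
Qed.

Lemma gal_class_is_zmod_morphism g : zmod_morphism (gal_class g).
Proof.
elim/quotW=> I; elim/quotW=> J.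
by rewrite -(raddfB (\pi_(class_group L))) !gal_class_pi raddfB raddfB.
Qed.

HB.instance Definition _ g := GRing.isZmodMorphism.Build
  (class_group L) (class_group L) (gal_class g) (gal_class_is_zmod_morphism g).

Definition gal_class_modp p g (x : class_group_modp L p) : class_group_modp L p :=
  \pi_(class_group_modp L p) (gal_class g (generic_quotient.repr x)).

Lemma gal_class_modp_pi p g x :
  gal_class_modp g (\pi_(class_group_modp L p) x) =
  \pi_(class_group_modp L p) (gal_class g x).
Proof.
apply/eqP; rewrite /gal_class_modp -Quotient.idealrBE -raddfB /=.
have : generic_quotient.repr (\pi_(class_group_modp L p) x) - x
    \in @is_pmultiple L p.
  by rewrite Quotient.idealrBE reprK.
move=> /asboolP[y xE]; apply/asboolP; exists (gal_class g y).
by rewrite xE raddfMn.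
Qed.
End GaloisAction.

Section CyclotomicEigenspaces.
Variables (p : nat) (L : splittingFieldType rat).

(* zeta is a primitive p-th root of unity and L = Q(zeta). *)
Definition is_cyclotomic_generator (zeta : L) : Prop :=
  p.-primitive_root zeta /\ (<<1; zeta>> = {:L})%VS.

Variable zeta : L.

(* The mod-p cyclotomic character: g zeta = zeta ^+ cyclo_char g. *)
Definition cyclo_char (g : gal_of {:L}) : 'F_p :=
  odflt 0 [pick a : 'F_p | g zeta == zeta ^+ (a : nat)].

Lemma cyclo_charP (g : gal_of {:L}) : prime p -> is_cyclotomic_generator zeta ->
  g zeta = zeta ^+ (cyclo_char g : nat).
Proof.
move=> p_pr [zP _]; rewrite /cyclo_char; case: pickP => [a /eqP //|no_a].
have /(prim_rootP zP)[i gE] : g zeta ^+ p = 1.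
  by rewrite -rmorphXn /= (prim_expr_order zP) rmorph1.
have := no_a (i%:R : 'F_p); rewrite val_Fp_nat // modn_small ?ltn_ord //.
by rewrite gE eqxx.
Qed.

(* The exponent i is used through its representative in [0, p - 1[; as
   cyclo_char g is nonzero, its i-th power only depends on i mod p - 1. *)
Definition chi_eigenspace (i : 'Z_p.-1) : set (class_group_modp L p) :=
  [set x | forall g, g \in 'Gal({:L} / 1)%g ->
     gal_class_modp g x = Fp_scale (cyclo_char g ^+ (i : nat)) x]%classic.

Definition calE : {set 'Z_p.-1} :=
  finset (fun i => `[< exists2 x, chi_eigenspace i x & x != 0 >]).

Definition calEstar : {set 'Z_p.-1} :=
  [set p%:R - eps | eps in calE] :\: [set 0; p.-1./2%:R].

Definition calEbar : {set 'Z_p.-1} := calEstar :|: [set 0; 1; p.-1./2%:R].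
End CyclotomicEigenspaces.

Lemma cyclotomic_field_exists p : prime p ->
  exists (L : splittingFieldType rat) (zeta : L),
    is_cyclotomic_generator p zeta.
Proof.
move=> p_pr.
have [L _ [_ _ [w [wP wgen] _]]] :=
  @group_num_field_exists 'Z_p [set: 'Z_p]%G.
exists L, w; split=> //.
by move: wP; rewrite cardsT card_ord Zp_cast // prime_gt1.
Qed.

(* Main.v *)
Require Import Defs.
From mathcomp Require Import all_boot all_order all_algebra all_field.
From mathcomp Require Import zify.
Import GRing.Theory.
Local Open Scope ring_scope.

(** Only the cardinality e of [calEstar] matters. The equations (a) exclude at
    most 4e + 12 < p - 1 values of alpha; fix any other one. Half of the p - 1
    residues beta make alpha + beta odd. For such a beta the equations (a) can
    only be met by even eps and the equations (b) only by odd eps, so that each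
    eps excludes at most 4 values of beta, and only 2 if eps = - eps, that is,
    if eps = 0 or eps = (p - 1) / 2. Altogether at most 4e + 8 < (p - 1) / 2
    values of beta are excluded. *)

Section EvenModulus.
Variable N : nat.
Hypotheses (N_gt1 : (1 < N)%N) (N_even : ~~ odd N).
Implicit Types (x y z eps alpha beta : 'Z_N) (S : {set 'Z_N}).

(** ['Z_N] consists of the ordinals below [N.-2.+2], which equals [N] because [1 < N]. *)
Lemma Zp_lt x : (x < N)%N.
Proof. by rewrite -[X in (_ < X)%N](Zp_cast N_gt1) ltn_ord. Qed.

(** Reduction modulo the even number [N] preserves parity. *)
Lemma odd_ZpD x y : odd (x + y)%R = odd x (+) odd y.
Proof. by rewrite /= odd_mod ?oddD // Zp_cast //; apply: negbTE. Qed.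

Lemma odd_ZpN x : odd (- x)%R = odd x.
Proof.
by have := odd_ZpD x (- x); rewrite subrr; case: (odd x); case: (odd (- x)%R).
Qed.

Lemma Zp_half_double : N./2%:R + N./2%:R = 0 :> 'Z_N.
Proof. by rewrite -natrD addnn even_halfK // pchar_Zp. Qed.

Lemma Zp_oppr_half : - N./2%:R = N./2%:R :> 'Z_N.
Proof. by apply/eqP; rewrite eq_sym -addr_eq0 Zp_half_double. Qed.

(** As a natural number, [z + z] is a multiple of [N] below [2 * N], hence 0 or [N]. *)
Lemma Zp_double_eq0 z : z + z = 0 -> z = 0 \/ z = N./2%:R.
Proof.
move=> /(congr1 (@nat_of_ord _)) zz.
have {zz} /dvdnP[k zk] : (N %| z + z)%N.
  by move: zz => /= /eqP; rewrite [X in (_ %% X)%N]Zp_cast.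
have zN := Zp_lt z; have NE : (N./2 * 2 = N)%N by rewrite muln2 even_halfK.
have [z0|zh] : nat_of_ord z = 0%N \/ nat_of_ord z = N./2.
- have : (k < 2)%N by rewrite -(ltn_pmul2r (ltnW N_gt1)); lia.
  by case: k zk => [|[|]] // zk _; lia.
- by left; apply: val_inj.
- by right; rewrite -zh natr_Zp.
Qed.

Definition Zp_halves y : {set 'Z_N} := [set x | x + x == y].

(** Two halves of [y] differ by an element whose double is 0, so a single half [x] determines the
    only other candidate, [x + N./2%:R]. *)
Lemma card_Zp_halves y : (#|Zp_halves y| <= 2)%N.
Proof.
have [->|[x]] := set_0Vmem (Zp_halves y); first by rewrite cards0.
rewrite inE => /eqP xy.
apply: (@leq_trans #|[set x; x + N./2%:R]|); last by rewrite cards2; case: eqP.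
apply/subset_leq_card/subsetP => z; rewrite !inE => /eqP zy.
have [|/eqP|zE] := Zp_double_eq0 (z - x).
- by rewrite addrACA zy -opprD xy subrr.
- by rewrite subr_eq0 => ->.
- by rewrite -zE addrC subrK eqxx orbT.
Qed.

Lemma card_Zp_halvesU y z : (#|Zp_halves y :|: Zp_halves z| <= 4)%N.
Proof.
apply: leq_trans (leq_card_setU _ _) _.
by rewrite (@leq_add _ _ 2 2) ?card_Zp_halves.
Qed.

Lemma card_bigcup_le (A : 'Z_N -> {set 'Z_N}) k S :
  (forall x, #|A x| <= k)%N -> (#|\bigcup_(x in S) A x| <= k * #|S|)%N.
Proof.
move=> Ak; rewrite mulnC -sum_nat_const.
elim/big_rec2: _ => [|x m B _ Bm]; first by rewrite cards0.
by apply: leq_trans (leq_card_setU _ _) _; apply: leq_add.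
Qed.

Definition opposite_parity alpha : {set 'Z_N} :=
  [set beta | odd (alpha + beta)%R].

(** Translation by 1 flips parity, so it injects the complement into the set itself. *)
Lemma card_opposite_parity alpha : (N./2 <= #|opposite_parity alpha|)%N.
Proof.
set P := opposite_parity alpha.
have : (#|~: P| <= #|P|)%N.
  rewrite -(card_imset _ (addrI 1)).
  apply/subset_leq_card/subsetP => _ /imsetP[x + ->].
  by rewrite !inE !odd_ZpD; case: (odd alpha); case: (odd x).
have := cardsC P; rewrite card_ord [RHS]Zp_cast // => PN.
have NE : (N./2 * 2 = N)%N by rewrite muln2 even_halfK.
by lia.
Qed.

Definition bad_double eps : {set 'Z_N} := Zp_halves eps :|: Zp_halves (- eps).

Definition bad_shift alpha eps : {set 'Z_N} :=
  [set alpha + eps; alpha - eps; - alpha + eps; - alpha - eps].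

(** The intersection with [opposite_parity alpha] is what brings the count per [eps] from 8 down to
    4: the parity of [eps] rules out one of the two sets. *)
Definition bad alpha eps : {set 'Z_N} :=
  opposite_parity alpha :&: (bad_double eps :|: bad_shift alpha eps).

(** If [beta] is [alpha] or [- alpha] shifted by an even [eps], then [alpha + beta] is even. *)
Lemma bad_even alpha eps : ~~ odd eps -> bad alpha eps \subset bad_double eps.
Proof.
move=> eps_even; apply/subsetP=> beta; case/setIP=> + /setUP[//|].
rewrite !inE odd_ZpD -!orbA => odd_ab /or4P[] /eqP betaE; move: odd_ab;
  by rewrite betaE odd_ZpD ?odd_ZpN (negPf eps_even) addbF addbb.
Qed.

(** A double is even, so it is neither [eps] nor [- eps]. *)
Lemma bad_odd alpha eps : odd eps -> bad alpha eps \subset bad_shift alpha eps.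
Proof.
move=> eps_odd; apply/subsetP=> beta; case/setIP=> _ /setUP[|//].
rewrite !inE => /orP[] /eqP /(congr1 (fun x : 'Z_N => odd x)).
  by rewrite odd_ZpD eps_odd addbb.
by rewrite odd_ZpD odd_ZpN eps_odd addbb.
Qed.

Lemma card_bad_shift alpha eps : (#|bad_shift alpha eps| <= 4)%N.
Proof.
by rewrite /bad_shift !cardsU !cards1; lia.
Qed.

Lemma card_bad alpha eps : (#|bad alpha eps| <= 4)%N.
Proof.
have [eps_odd|eps_even] := boolP (odd eps).
  exact: leq_trans (subset_leq_card (bad_odd _ _ eps_odd)) (card_bad_shift _ _).
exact: leq_trans (subset_leq_card (bad_even _ _ eps_even)) (card_Zp_halvesU _ _).
Qed.

(** The sign of [eps] no longer matters: the four shifts collapse to two, and the two sets of halves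
    coincide. *)
Lemma card_bad_oppr_id alpha eps : - eps = eps -> (#|bad alpha eps| <= 2)%N.
Proof.
move=> epsN; have [eps_odd|eps_even] := boolP (odd eps).
  apply: leq_trans (subset_leq_card (bad_odd _ _ eps_odd)) _.
  rewrite /bad_shift epsN -setUA !setUid cards2.
  by case: eqP.
apply: leq_trans (subset_leq_card (bad_even _ _ eps_even)) _.
by rewrite /bad_double epsN setUid card_Zp_halves.
Qed.

Lemma exists_Zp_pair S : (4 * #|S| + 8 < N./2)%N ->
  let Sbar := S :|: [set 0; 1; N./2%:R] in
  exists alpha beta,
    [/\ odd (alpha + beta)%R,
        forall eps, eps \in Sbar ->
          alpha \notin bad_double eps /\ beta \notin bad_double eps
      & forall eps, eps \in Sbar -> beta \notin bad_shift alpha eps].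
Proof.
move=> S_small Sbar.
have NE : (N./2 * 2 = N)%N by rewrite muln2 even_halfK.
have Sbar_card : (#|Sbar| <= #|S| + 3)%N.
  apply: leq_trans (leq_card_setU _ _) _; rewrite leq_add2l.
  apply: leq_trans (leq_card_setU _ _) _; rewrite cards1 cards2.
  by case: eqP.
(* At most [4 * (#|S| + 3)] values are excluded, and doubling the hypothesis gives
   [8 * #|S| + 16 < N]. *)
have [alpha alphaP] : exists alpha,
    alpha \notin \bigcup_(eps in Sbar) bad_double eps.
  apply/existsP; rewrite -negb_forall; apply/negP => /forallP all_bad.
  have := card_bigcup_le bad_double 4 Sbar (fun _ => card_Zp_halvesU _ _).
  have -> : \bigcup_(eps in Sbar) bad_double eps = setT.
    by apply/setP=> x; rewrite all_bad inE.
  by rewrite cardsT card_ord [X in (X <= _)%N]Zp_cast //; lia.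
have bad_card : (#|\bigcup_(eps in Sbar) bad alpha eps| <= 4 * #|S| + 8)%N.
  (* The self-opposite elements 0 and [N./2%:R] are split off, costing 2 each; 1 and the elements of
     [S] cost 4 each. *)
  have -> : Sbar = 0 |: (N./2%:R |: (1 |: S)).
    by apply/setP=> x; rewrite !inE; do !case: (_ == _); rewrite ?orbT ?orbF.
  rewrite !bigcup_setU !big_set1.
  have b0 := card_bad_oppr_id alpha 0 (oppr0 _).
  have bh := card_bad_oppr_id alpha _ Zp_oppr_half.
  have b1 := card_bad alpha 1.
  have bS := card_bigcup_le (bad alpha) 4 S (card_bad alpha).
  apply: leq_trans (leq_card_setU _ _) _; rewrite addnC.
  rewrite [X in (_ <= X)%N](_ : _ = 4 * #|S| + 4 + 2 + 2)%N; last by lia.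
  apply: leq_add b0; apply: leq_trans (leq_card_setU _ _) _; rewrite addnC.
  apply: leq_add bh; apply: leq_trans (leq_card_setU _ _) _; rewrite addnC.
  exact: leq_add.
(* At least [N./2] candidates have the right parity, more than the number of bad ones. *)
have [beta beta_odd beta_good] : exists2 beta, beta \in opposite_parity alpha
    & beta \notin \bigcup_(eps in Sbar) bad alpha eps.
  apply/subsetPn/negP => /subset_leq_card; have := card_opposite_parity alpha.
  by lia.
have {}beta_good eps : eps \in Sbar ->
    beta \notin bad_double eps :|: bad_shift alpha eps.
  move=> epsS; apply: contra beta_good => beta_bad; apply/bigcupP.
  by exists eps; rewrite // inE beta_odd.
exists alpha, beta; split=> [|eps epsS|eps epsS].
- by move: beta_odd; rewrite inE.
- split; last by have := beta_good eps epsS; rewrite inE negb_or => /andP[].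
  by apply: contra alphaP => ?; apply/bigcupP; exists eps.
- by have := beta_good eps epsS; rewrite inE negb_or => /andP[].
Qed.
End EvenModulus.

Theorem theorem5p6 (p : nat) (L : splittingFieldType rat) (zeta : L)
    (p_prime : prime p) (p_odd : odd p)
    (zetaP : is_cyclotomic_generator p zeta) :
  (4 * #|calEstar p zeta| + 8 < p.-1./2)%N ->
  exists alpha beta : 'Z_p.-1,
    [/\ odd (nat_of_ord (alpha + beta)),
        forall eps, eps \in calEbar p zeta ->
          [/\ 2%:R * alpha <> eps, 2%:R * alpha <> - eps,
              2%:R * beta <> eps & 2%:R * beta <> - eps]
      & forall eps, eps \in calEbar p zeta ->
          [/\ beta <> alpha + eps, beta <> alpha - eps,
              beta <> - alpha + eps & beta <> - alpha - eps]].
Proof.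
move=> small; have N_gt1 : (1 < p.-1)%N by lia.
have N_even : ~~ odd p.-1 by have := prime_gt0 p_prime; lia.
have [alpha [beta [odd_ab double_ab shift_ab]]] :=
  exists_Zp_pair _ N_gt1 N_even _ small.
exists alpha, beta; split=> // eps eps_bar.
  have [] := double_ab eps eps_bar; rewrite !inE !negb_or !mulr_natl !mulr2n.
  by move=> /andP[/eqP ? /eqP ?] /andP[/eqP ? /eqP ?].
have := shift_ab eps eps_bar; rewrite !inE !negb_or -!andbA.
by case/and4P=> /eqP ? /eqP ? /eqP ? /eqP ?.
Qed.
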